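(* Let $X$ be a real strictly convex smooth normed linear space of dimension $2$. Then $S_X$ is a Radon curve if and only if for each point $x \in S_X$ there exists a strongly orthonormal Hamel basis of $X$ in the sense of Birkhoff-James containing $x$.
   Context: $S_X = \{x \in X : \|x\| = 1\}$ and $B_X = \{x \in X : \|x\| \le 1\}$. $X$ is strictly convex iff every element of $S_X$ is an extreme point of $B_X$. $X$ is smooth iff at each point of $S_X$ the supporting line (hyperplane) to $B_X$ is unique. $x \perp_B y$ (Birkhoff-James orthogonality) iff $\|x\| \le \|x + \lambda y\|$ for all scalars $\lambda$. The unit sphere $S_X$ of a two-dimensional real normed linear space $X$ is a Radon curve iff Birkhoff-James orthogonality in $X$ is symmetric, i.e. $x \perp_B y$ implies $y \perp_B x$ for all $x, y \in X$. A set $\{e_1, e_2\}$ is a strongly orthonormal Hamel basis in the sense of Birkhoff-James iff it is a Hamel basis of $X$, $\|e_1\| = \|e_2\| = 1$, and $\|e_1\| < \|e_1 + \lambda e_2\|$ and $\|e_2\| < \|e_2 + \lambda e_1\|$ for all scalars $\lambda \ne 0$. *)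

(* Defs.v *)
From HB Require Import structures.
From mathcomp Require Import all_boot all_order all_algebra.
From mathcomp Require Import all_classical all_reals all_analysis.
Import Order.TTheory GRing.Theory Num.Theory.
Import numFieldNormedType.Exports.

Local Open Scope classical_set_scope.
Local Open Scope ring_scope.

(* The norm and the finite-dimensional structure share the same vector space
   operations; the norm itself is arbitrary. *)
#[short(type="normedVectType")]
HB.structure Definition NormedVector (R : numFieldType) :=
  {V of NormedModule R V & Vector R V}.

Definition unit_sphere {R : realType} (X : normedModType R) : set X :=
  [set x | `|x| = 1].

Definition unit_ball {R : realType} (X : normedModType R) : set X :=
  [set x | `|x| <= 1].

Definition extreme_point {R : realType} {X : normedModType R}
    (A : set X) (x : X) : Prop :=
  A x /\
  forall (y z : X) (t : R), A y -> A z -> 0 < t -> t < 1 ->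
    x = t *: y + (1 - t) *: z -> y = x /\ z = x.

Definition strictly_convex {R : realType} (X : normedModType R) : Prop :=
  forall x : X, unit_sphere X x -> extreme_point (unit_ball X) x.

(* Continuity of [f] is not required: when [A] is the unit ball, [f] is bounded
   above on it, hence continuous. *)
Definition supporting_hyperplane {R : realType} {X : normedModType R}
    (A : set X) (x : X) (H : set X) : Prop :=
  exists (f : {scalar X}) (c : R),
    [/\ exists v : X, f v != 0,
        H = [set y | f y = c],
        H x &
        forall y : X, A y -> f y <= c].

Definition smooth {R : realType} (X : normedModType R) : Prop :=
  forall x : X, unit_sphere X x ->
    exists! H : set X, supporting_hyperplane (unit_ball X) x H.

Definition bj_orthogonal {R : realType} {X : normedModType R} 
    (x y : X) : Prop :=
  forall l : R, `|x| <= `|x + l *: y|.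

(* Meant for two-dimensional [X]. *)
Definition radon_unit_sphere {R : realType} (X : normedModType R) : Prop :=
  forall x y : X, bj_orthogonal x y -> bj_orthogonal y x.

Definition strongly_orthonormal_basis {R : realType} {X : normedVectType R}
    (e1 e2 : X) : Prop :=
  [/\ basis_of (fullv : {vspace X}) [:: e1; e2],
      `|e1| = 1,
      `|e2| = 1,
      forall l : R, l != 0 -> `|e1| < `|e1 + l *: e2| &
      forall l : R, l != 0 -> `|e2| < `|e2 + l *: e1|].

(* Main.v *)
Require Import Defs.
From HB Require Import structures.
From mathcomp Require Import all_boot all_order all_algebra.
From mathcomp Require Import all_classical all_reals all_analysis.
Import Order.TTheory GRing.Theory Num.Theory.
Import numFieldNormedType.Exports.
Local Open Scope classical_set_scope.
Local Open Scope ring_scope.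

(** In a smooth plane the Birkhoff-James orthogonal directions of a unit vector
    [x] correspond to the supporting lines at [x]: the kernel of a supporting
    functional is orthogonal to [x], and if [x] is orthogonal to [y != 0] then
    the coordinate along [x] in the basis [x, y] is a supporting functional.
    Smoothness thus says that this direction is unique, while strict convexity
    makes the inequalities defining orthogonality strict. Symmetry of
    orthogonality at [x] therefore amounts to the unique orthogonal direction
    being orthogonal back to [x]. *)

Section BirkhoffJames.
Context {R : realType} {X : normedModType R}.
Implicit Types x y : X.

Lemma bj_orthogonal0l y : bj_orthogonal 0 y.
Proof. by move=> l; rewrite normr0. Qed.

Lemma bj_orthogonal0r x : bj_orthogonal x 0.
Proof. by move=> l; rewrite scaler0 addr0. Qed.

Lemma bj_orthogonalZ {a b : R} {x y} :
  bj_orthogonal x y -> bj_orthogonal (a *: x) (b *: y).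
Proof.
move=> xy l; have [->|a0] := eqVneq a 0.
  by rewrite scale0r; exact: bj_orthogonal0l.
have -> : a *: x + l *: (b *: y) = a *: (x + (l * b / a) *: y).
  by rewrite scalerDr !scalerA mulrCA divff// mulr1.
by rewrite !normrZ ler_wpM2l.
Qed.

(** If [x = l *: y], the scalar [- l] makes the perturbed vector vanish, which forces [|x| <= 0]. *)
Lemma bj_orthogonal_notin_line {x y} (l : R) :
  x != 0 -> bj_orthogonal x y -> x != l *: y.
Proof.
move=> x0 xy; apply/eqP => xly; move: (xy (- l)).
by rewrite scaleNr -xly subrr normr0 normr_le0 (negPf x0).
Qed.

(* An equality [|x + l *: y| = |x|] would make [x + (l / 2) *: y], the midpoint
   of two points of the ball, a non-extreme point of the sphere. *)
Lemma strictly_convex_bj_orthogonal_lt {x y} :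
  strictly_convex X -> `|x| = 1 -> y != 0 -> bj_orthogonal x y ->
  forall l : R, l != 0 -> `|x| < `|x + l *: y|.
Proof.
move=> convX x1 y0 xy l l0; rewrite lt_neqAle xy andbT; apply/eqP => eqn.
pose m := x + (l / 2) *: y.
have mE : m = 2^-1 *: x + (1 - 2^-1) *: (x + l *: y).
  rewrite (_ : 1 - 2^-1 = 2^-1 :> R); last by rewrite {1}[1]splitr mul1r addrK.
  rewrite scalerDr addrA -scalerDl scalerA [2^-1 * l]mulrC.
  by rewrite -[2^-1 in X in _ = X *: _ + _]mul1r -splitr scale1r.
(* Orthogonality bounds [|m|] from below, the triangle inequality from above. *)
have m1 : `|m| = 1.
  apply/eqP; rewrite eq_le -[X in _ && (X <= _)]x1 xy andbT mE.
  rewrite (le_trans (ler_normD _ _))// !normrZ -eqn x1 !mulr1.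
  by rewrite !ger0_norm ?subr_ge0 ?invf_le1 ?invr_ge0 ?ler1n// addrC subrK.
have [_ /(_ x (x + l *: y) 2^-1)] := convX m m1.
rewrite /unit_ball /= -eqn x1 lexx invr_gt0 ltr0n invf_lt1 ?ltr1n ?ltr0n//.
case=> // xm _; move/eqP: xm; rewrite -subr_eq0 opprD addrA subrr sub0r oppr_eq0.
by rewrite scaler_eq0 (negPf y0) orbF mulf_eq0 (negPf l0) invr_eq0 pnatr_eq0.
Qed.

(** Moving along [y] keeps the value [c] of [f]; normalizing [x + l *: y] into the ball divides this
    value by its norm, and the bound [c] then forces that norm to be at least 1. *)
Lemma support_bj_orthogonal {f : {scalar X}} {c : R} {x y} :
  0 < c -> `|x| = 1 -> f x = c -> (forall z, unit_ball X z -> f z <= c) ->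
  f y = 0 -> bj_orthogonal x y.
Proof.
move=> c0 x1 fx fc fy l; rewrite x1.
have fz : f (x + l *: y) = c by rewrite linearD linearZ /= fx fy mulr0 addr0.
have z0 : 0 < `|x + l *: y|.
  rewrite normr_gt0; apply: contra_eq_neq fz => ->.
  by rewrite linear0 lt_eqF.
have := fc (`|x + l *: y|^-1 *: (x + l *: y)).
rewrite linearZ /= fz /unit_ball /= normrZ normfV normr_id mulVf ?gt_eqF//.
by move=> /(_ (lexx _)); rewrite ger_pMl// invf_le1.
Qed.

Lemma support_gt0 {f : {scalar X}} {c : R} :
  (exists v, f v != 0) -> (forall z, unit_ball X z -> f z <= c) -> 0 < c.
Proof.
move=> [v fv] fc; have v0 : v != 0 by apply: contraNneq fv => ->; rewrite linear0.
(* Normalizing [v], with the sign that makes [f] positive, gives a point of the ball. *)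
pose w := (Num.sg (f v) / `|v|) *: v.
have fw : f w = `|f v| / `|v| by rewrite linearZ /= mulrAC -normrEsg.
apply: lt_le_trans (fc w _); first by rewrite fw divr_gt0 ?normr_gt0.
by rewrite /unit_ball /= normrZ normrM normfV normr_id normr_sg fv mul1r mulVf ?normr_eq0.
Qed.

End BirkhoffJames.

Section Plane.
Context {R : realType} {X : normedVectType R}.
Hypothesis dimX : \dim (fullv : {vspace X}) = 2%N.
Implicit Types x y : X.

Lemma bj_orthogonal_basis {x y} : x != 0 -> y != 0 -> bj_orthogonal x y ->
  basis_of (fullv : {vspace X}) [:: x; y].
Proof.
move=> x0 y0 xy; rewrite basisEfree dimX subvf leqnn !andbT.
rewrite free_cons seq1_free y0 andbT span_seq1.
by apply/vlineP => -[l]; apply/eqP/bj_orthogonal_notin_line.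
Qed.

Lemma bj_orthogonal_support {x y} : `|x| = 1 -> y != 0 -> bj_orthogonal x y ->
  exists f : {scalar X},
    [/\ f x = 1, f y = 0 & forall z, unit_ball X z -> f z <= 1].
Proof.
move=> x1 y0 xy; have x0 : x != 0 by rewrite -normr_eq0 x1 oner_eq0.
have bxy := bj_orthogonal_basis x0 y0 xy.
pose t := [tuple x; y]; have ft : free t := basis_free bxy.
exists (coord t ord0 : {scalar X}); split => [||z z1].
- by have := coord_free ord0 ord0 ft; rewrite eqxx.
- by have := coord_free (lift ord0 ord0) ord0 ft; rewrite eq_sym (negPf (neq_lift _ _)).
have := @coord_basis _ _ _ _ t z bxy (memvf z).
rewrite big_ord_recl big_ord1 /=.
set a := coord t ord0 z; set b := coord _ _ z => zE.
(* Since [a *: x] is orthogonal to [y], [|a| = |a *: x| <= |a *: x + b *: y| = |z|]. *)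
have a1 := bj_orthogonalZ (a := a) (b := 1) xy b.
move: a1; rewrite scale1r -zE normrZ x1 mulr1 => az.
by rewrite (le_trans (ler_norm _))// (le_trans az).
Qed.

Lemma bj_orthogonal_hyperplane {f : {scalar X}} {x} :
  `|x| = 1 -> f x = 1 -> (forall z, unit_ball X z -> f z <= 1) ->
  supporting_hyperplane (unit_ball X) x [set z | f z = 1].
Proof.
move=> x1 fx f1; exists f, 1; split => //.
by exists x; rewrite fx oner_neq0.
Qed.

(** The functionals at [x] vanishing on [y] and on [z] cut out the same supporting line. It contains
    [x + z], so [f z = 0], and [z] has no component along [x]. *)
Lemma smooth_bj_orthogonal_unique {x y z} : smooth X -> `|x| = 1 -> y != 0 ->
  bj_orthogonal x y -> bj_orthogonal x z -> exists a : R, z = a *: y.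
Proof.
move=> smoothX x1 y0 xy xz.
have [->|z0] := eqVneq z 0; first by exists 0; rewrite scale0r.
have [f [fx fy f1]] := bj_orthogonal_support x1 y0 xy.
have [g [gx gz g1]] := bj_orthogonal_support x1 z0 xz.
have [H [_ HU]] := smoothX x x1.
have fg : [set w | f w = 1] = [set w | g w = 1].
  by rewrite -(HU _ (bj_orthogonal_hyperplane x1 fx f1))
             -(HU _ (bj_orthogonal_hyperplane x1 gx g1)).
have : [set w | g w = 1] (x + z) by rewrite /= linearD /= gx gz addr0.
rewrite -fg /= linearD /= fx => /(canRL (addKr _)); rewrite addNr => fz.
have x0 : x != 0 by rewrite -normr_eq0 x1 oner_eq0.
have : z \in <<[:: x; y]>>%VS.
  by rewrite (span_basis (bj_orthogonal_basis x0 y0 xy)) memvf.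
rewrite span_cons span_seq1 => /memv_addP[_ /vlineP[a ->] [_ /vlineP[b ->] zE]].
move: fz; rewrite zE linearD !linearZ /= fx fy mulr0 mulr1 addr0 => ->.
by exists b; rewrite scale0r add0r.
Qed.

Lemma smooth_bj_orthogonal_exists {x} : smooth X -> `|x| = 1 ->
  exists2 y, `|y| = 1 & bj_orthogonal x y.
Proof.
move=> smoothX x1; have [H [[f [c [fn0 -> fx fc]]] _]] := smoothX x x1.
have c0 := support_gt0 fn0 fc.
have /subvPn[z _ zx] : ~~ (fullv <= <[x]>)%VS.
  by apply/negP => /dimvS; rewrite dimX dim_vline; case: eqP.
(* Projecting [z] along [x] onto the kernel of [f]; the result is nonzero because [z] lies off the
   line of [x]. *)
pose w := z - (f z / c) *: x.
have fw : f w = 0.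
  by rewrite linearB linearZ /= [f x]fx divfK ?subrr// gt_eqF.
have w0 : w != 0.
  apply: contraNneq zx => /eqP; rewrite subr_eq0 => /eqP ->.
  by apply/vlineP; exists (f z / c).
exists (`|w|^-1 *: w).
  by rewrite normrZ normfV normr_id mulVf// normr_eq0.
by apply: (support_bj_orthogonal c0 x1 fx fc); rewrite linearZ /= fw mulr0.
Qed.

End Plane.

Theorem theorem4p3 (R : realType) (X : normedVectType R)
    (dimX : \dim (fullv : {vspace X}) = 2%N)
    (convX : strictly_convex X) (smoothX : smooth X) :
  radon_unit_sphere X <->
  forall x : X, unit_sphere X x ->
    exists e1 e2 : X,
      strongly_orthonormal_basis e1 e2 /\ x \in [:: e1; e2].
Proof.
have unit_neq0 (x : X) : `|x| = 1 -> x != 0.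
  by move=> x1; rewrite -normr_eq0 x1 oner_eq0.
have lt_bj (x y : X) :
    (forall l : R, l != 0 -> `|x| < `|x + l *: y|) -> bj_orthogonal x y.
  move=> xy l; have [->|/xy/ltW//] := eqVneq l 0.
  by rewrite scale0r addr0.
split=> [radonX x x1|onbX x y xy].
  have [y y1 xy] := smooth_bj_orthogonal_exists dimX smoothX x1.
  have [x0 y0] := (unit_neq0 x x1, unit_neq0 y y1).
  exists x, y; split; last by rewrite mem_head.
  split=> //; first exact: bj_orthogonal_basis.
    exact: strictly_convex_bj_orthogonal_lt.
  exact: strictly_convex_bj_orthogonal_lt (radonX _ _ xy).
have [->|x0] := eqVneq x 0; first exact: bj_orthogonal0r.
have nx0 : `|x| != 0 by rewrite normr_eq0.
pose u := `|x|^-1 *: x.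
have u1 : `|u| = 1 by rewrite normrZ normfV normr_id mulVf.
have xE : x = `|x| *: u by rewrite scalerA divff// scale1r.
(* The vector [u] may be either member of the basis; the other one serves as [v], since the basis
   conditions are symmetric. *)
have [v [v1 uv vu]] : exists v : X,
    [/\ `|v| = 1, bj_orthogonal u v & bj_orthogonal v u].
  have [e1 [e2 [[_ n1 n2 /lt_bj e12 /lt_bj e21]]]] := onbX u u1.
  by rewrite !inE => /orP[]/eqP ->; [exists e2 | exists e1].
have uy : bj_orthogonal u y.
  by move: (bj_orthogonalZ (a := `|x|^-1) (b := 1) xy); rewrite scale1r.
(* Both [v] and [y] are orthogonal directions of [u], so [y] is a multiple of [v], and [vu] rescales
   to the goal. *)
have [a ->] := smooth_bj_orthogonal_unique dimX smoothX u1 (unit_neq0 v v1) uv uy.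
by rewrite xE; exact: bj_orthogonalZ.
Qed.
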